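(* Let $R$ be a commutative ring and $I\subset R$ be the ideal generated by a finite set of elements $s_1,\dots,s_m\in R$. Assume that an $R$-module $C$ is $s_j$-contraadjusted for every $j=1,\dots,m$. Then the $R$-module $C$ is $I$-adically complete.
   Context: For $s\in R$, an $R$-module $C$ is $s$-contraadjusted if $\operatorname{Ext}^1_R(R[s^{-1}],C)=0$, where $R[s^{-1}]$ is the localization of $R$ at $\{1,s,s^2,\dots\}$. An $R$-module $C$ is called $I$-adically complete if the natural map $C\to\varprojlim_{n\ge1}C/I^nC$ is surjective (injectivity is not required). *)

(* Defs.v *)
From HB Require Import structures.
From mathcomp Require Import all_boot all_algebra.
From mathcomp Require Import boolp classical_sets.
From mathcomp Require Import zify ring.

Set Implicit Arguments.
Unset Strict Implicit.
Unset Printing Implicit Defensive.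

Import GRing.Theory.
Local Open Scope classical_set_scope.
Local Open Scope ring_scope.
Local Open Scope quotient_scope.

(* Rings are [comPzRingType], so that the zero ring is allowed. *)

Section Localization.
Variables (R : comPzRingType) (s : R).

(* The pair (a, n) stands for the fraction a / s ^ n. *)
Definition loc_eq (x y : R * nat) : bool :=
  `[< exists k, s ^+ k * (s ^+ y.2 * x.1) = s ^+ k * (s ^+ x.2 * y.1) >].

Lemma loc_eq_equiv : equiv_class_of loc_eq.
Proof.
split=> [x|x y|y x z]; first by apply/asboolP; exists 0.
  by apply/asboolP/asboolP => -[k e]; exists k.
move=> /asboolP[k e] /asboolP[l f]; apply/asboolP.
exists (k + l + y.2)%N; rewrite !exprD.
transitivity (s ^+ l * s ^+ z.2 * (s ^+ k * (s ^+ y.2 * x.1))).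
  by rewrite !mulrA; congr (_ * _); rewrite -!exprD; congr (s ^+ _); lia.
rewrite e.
transitivity (s ^+ k * s ^+ x.2 * (s ^+ l * (s ^+ z.2 * y.1))).
  by rewrite !mulrA; congr (_ * _); rewrite -!exprD; congr (s ^+ _); lia.
rewrite f !mulrA; congr (_ * _); rewrite -!exprD; congr (s ^+ _); lia.
Qed.
Canonical loc_eq_equivRel := EquivRelPack loc_eq_equiv.
Canonical loc_eq_encModRel := defaultEncModRel loc_eq.

Definition localization := {eq_quot loc_eq}.
HB.instance Definition _ := EqQuotient.on localization.
HB.instance Definition _ := Choice.on localization.

Definition frac (a : R) (n : nat) : localization := \pi_localization (a, n).

Lemma fracP a m b n : reflect
  (exists k, s ^+ k * (s ^+ n * a) = s ^+ k * (s ^+ m * b))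
  (frac a m == frac b n).
Proof. by rewrite /frac piE; exact: asboolP. Qed.

Lemma frac_eq a m b n : s ^+ n * a = s ^+ m * b -> frac a m = frac b n.
Proof. by move=> e; apply/eqP/fracP; exists 0; rewrite e. Qed.

Lemma fracW (P : localization -> Prop) :
  (forall a n, P (frac a n)) -> forall x, P x.
Proof. by move=> Pf x; rewrite -[x]reprK; case: (repr x). Qed.

Lemma frac_repr (x : localization) : frac (repr x).1 (repr x).2 = x.
Proof. by rewrite /frac -surjective_pairing reprK. Qed.

Lemma repr_frac a m : exists k,
  s ^+ k * (s ^+ m * (repr (frac a m)).1) = s ^+ k * (s ^+ (repr (frac a m)).2 * a).
Proof. by apply/fracP; rewrite frac_repr. Qed.

Definition loc_opp (x : localization) := frac (- (repr x).1) (repr x).2.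
Definition loc_add (x y : localization) :=
  frac (s ^+ (repr y).2 * (repr x).1 + s ^+ (repr x).2 * (repr y).1)
       ((repr x).2 + (repr y).2)%N.
Definition loc_mul (x y : localization) :=
  frac ((repr x).1 * (repr y).1) ((repr x).2 + (repr y).2)%N.
Definition loc_scale (r : R) (x : localization) :=
  frac (r * (repr x).1) (repr x).2.

Lemma loc_oppE a n : loc_opp (frac a n) = frac (- a) n.
Proof.
have [k e] := repr_frac a n.
by apply/eqP/fracP; exists k; rewrite !mulrN e.
Qed.

Lemma loc_scaleE r a n : loc_scale r (frac a n) = frac (r * a) n.
Proof.
have [k e] := repr_frac a n.
by apply/eqP/fracP; exists k; rewrite !(mulrCA _ r) e.
Qed.

Lemma loc_addE a m b n :
  loc_add (frac a m) (frac b n) = frac (s ^+ n * a + s ^+ m * b) (m + n)%N.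
Proof.
have [k e] := repr_frac a m; have [l f] := repr_frac b n; rewrite /loc_add.
move: (repr (frac a m)) (repr (frac b n)) e f => [a' m'] [b' n'] /= e f.
apply/eqP/fracP; exists (k + l)%N; rewrite !exprD.
transitivity (s ^+ l * s ^+ n * s ^+ n' * (s ^+ k * (s ^+ m * a'))
            + s ^+ k * s ^+ m * s ^+ m' * (s ^+ l * (s ^+ n * b'))).
  by generalize (s ^+ k) (s ^+ l) (s ^+ m) (s ^+ n) (s ^+ m') (s ^+ n') => *; ring.
rewrite e f.
by generalize (s ^+ k) (s ^+ l) (s ^+ m) (s ^+ n) (s ^+ m') (s ^+ n') => *; ring.
Qed.

Lemma loc_mulE a m b n :
  loc_mul (frac a m) (frac b n) = frac (a * b) (m + n)%N.
Proof.
have [k e] := repr_frac a m; have [l f] := repr_frac b n; rewrite /loc_mul.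
move: (repr (frac a m)) (repr (frac b n)) e f => [a' m'] [b' n'] /= e f.
apply/eqP/fracP; exists (k + l)%N; rewrite !exprD.
transitivity ((s ^+ k * (s ^+ m * a')) * (s ^+ l * (s ^+ n * b'))).
  by generalize (s ^+ k) (s ^+ l) (s ^+ m) (s ^+ n) => *; ring.
rewrite e f.
by generalize (s ^+ k) (s ^+ l) (s ^+ m') (s ^+ n') => *; ring.
Qed.

Lemma loc_addA : associative loc_add.
Proof.
elim/fracW=> a m; elim/fracW=> b n; elim/fracW=> c p; rewrite !loc_addE.
apply: frac_eq; rewrite !exprD.
by generalize (s ^+ m) (s ^+ n) (s ^+ p) => *; ring.
Qed.

Lemma loc_addC : commutative loc_add.
Proof.
by elim/fracW=> a m; elim/fracW=> b n; rewrite !loc_addE addrC addnC.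
Qed.

Lemma loc_add0 : left_id (frac 0 0) loc_add.
Proof.
by elim/fracW=> a m; rewrite loc_addE mulr0 add0r expr0 mul1r add0n.
Qed.

Lemma loc_addN : left_inverse (frac 0 0) loc_opp loc_add.
Proof.
elim/fracW=> a m; rewrite loc_oppE loc_addE; apply: frac_eq.
by rewrite mulrN addNr !mulr0.
Qed.

HB.instance Definition _ :=
  GRing.isZmodule.Build localization loc_addA loc_addC loc_add0 loc_addN.

Lemma loc_mulA : associative loc_mul.
Proof.
by elim/fracW=> a m; elim/fracW=> b n; elim/fracW=> c p; rewrite !loc_mulE mulrA addnA.
Qed.

Lemma loc_mulC : commutative loc_mul.
Proof.
by elim/fracW=> a m; elim/fracW=> b n; rewrite !loc_mulE mulrC addnC.
Qed.

Lemma loc_mul1 : left_id (frac 1 0) loc_mul.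
Proof. by elim/fracW=> a m; rewrite loc_mulE mul1r. Qed.

Lemma loc_mulDl : left_distributive loc_mul loc_add.
Proof.
elim/fracW=> a m; elim/fracW=> b n; elim/fracW=> c p.
rewrite !(loc_addE, loc_mulE); apply: frac_eq; rewrite !exprD.
by generalize (s ^+ m) (s ^+ n) (s ^+ p) => *; ring.
Qed.

HB.instance Definition _ := GRing.Zmodule_isComPzRing.Build localization
  loc_mulA loc_mulC loc_mul1 loc_mulDl.

Lemma loc_scaleA a b x : loc_scale a (loc_scale b x) = loc_scale (a * b) x.
Proof. by elim/fracW: x => c m; rewrite !loc_scaleE mulrA. Qed.

Lemma loc_scale1 : left_id 1 loc_scale.
Proof. by elim/fracW=> a m; rewrite loc_scaleE mul1r. Qed.

Lemma loc_scaleDr : right_distributive loc_scale +%R.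
Proof.
move=> r; elim/fracW=> a m; elim/fracW=> b n.
rewrite /GRing.add /= !(loc_addE, loc_scaleE); congr frac.
by rewrite mulrDr !(mulrCA r).
Qed.

Lemma loc_scaleDl x : {morph loc_scale^~ x : a b / a + b}.
Proof.
elim/fracW: x => c m a b; rewrite /= !loc_scaleE.
rewrite [RHS]/GRing.add /= loc_addE; apply: frac_eq; rewrite exprD.
by generalize (s ^+ m) => *; ring.
Qed.

HB.instance Definition _ := GRing.Zmodule_isLmodule.Build R localization
  loc_scaleA loc_scale1 loc_scaleDr loc_scaleDl.

Lemma loc_scalerAl (r : R) (x y : localization) : r *: (x * y) = (r *: x) * y.
Proof.
elim/fracW: x => a m; elim/fracW: y => b n.
by rewrite /GRing.scale /GRing.mul /= !(loc_mulE, loc_scaleE) mulrA.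
Qed.

Lemma loc_sV : frac s 0 * frac 1 1 = 1 :> localization.
Proof.
rewrite /GRing.mul /GRing.one /= loc_mulE.
apply: frac_eq; rewrite expr0 mul1r add0n expr1.
by rewrite mulrC.
Qed.

End Localization.

Section Extensions.
Variables (R : pzRingType) (M C : lmodType R).

(* A short exact sequence 0 -> C -> E -> M -> 0. *)
Record extension := Extension {
  ext_mid :> lmodType R;
  ext_inj : {linear C -> ext_mid};
  ext_proj : {linear ext_mid -> M};
  ext_inj_inj : injective ext_inj;
  ext_proj_surj : forall x : M, exists e, ext_proj e = x;
  ext_exact : forall e, ext_proj e = 0 <-> exists c, ext_inj c = e
}.

Definition ext_equiv (E E' : extension) : Prop :=
  exists f : {linear E -> E'},
    [/\ bijective f, forall c, f (ext_inj E c) = ext_inj E' c &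
        forall e, ext_proj E' (f e) = ext_proj E e].

Definition split_inj (c : C) : C * M := (c, 0).

Lemma split_inj_is_linear : linear split_inj.
Proof. by move=> a u v; congr pair; rewrite /= scaler0 addr0. Qed.
HB.instance Definition _ :=
  GRing.isLinear.Build R C (C * M)%type _ split_inj split_inj_is_linear.

Definition split_proj (x : C * M) : M := x.2.

Lemma split_proj_is_linear : linear split_proj.
Proof. by []. Qed.
HB.instance Definition _ :=
  GRing.isLinear.Build R (C * M)%type M _ split_proj split_proj_is_linear.

Lemma split_inj_inj : injective split_inj.
Proof. by move=> c c' []. Qed.

Lemma split_proj_surj x : exists e, split_proj e = x.
Proof. by exists (0, x). Qed.

Lemma split_exact e : split_proj e = 0 <-> exists c, split_inj c = e.
Proof.
by case: e => c x; split => [/= ->|[c' [_ <-]]] //; exists c.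
Qed.

Definition split_extension : extension :=
  Extension split_inj_inj split_proj_surj split_exact.

(* Ext^1_R(M, C) is Yoneda's group of equivalence classes of extensions, whose
   zero is the class of the split extension. *)
Definition Ext1_eq0 : Prop := forall E : extension, ext_equiv E split_extension.

End Extensions.

Definition contraadjusted (R : comPzRingType) (s : R) (C : lmodType R) : Prop :=
  Ext1_eq0 (localization s) C.

Section Span.
Variables (R : pzRingType) (V : lmodType R).

(* The submodule generated by S: finite sums of a *: v with v in S. *)
Definition span (S : set V) : {pred V} := fun x =>
  `[< exists2 l : seq (R * V), (forall p, p \in l -> S p.2) &
        x = \sum_(p <- l) p.1 *: p.2 >].

Lemma span_closed (S : set V) : submod_closed (span S).
Proof.
split=> [|a x y /asboolP[k kS ->] /asboolP[l lS ->]]; apply/asboolP.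
  by exists [::]; rewrite ?big_nil.
exists ([seq (a * p.1, p.2) | p <- k] ++ l) => [p|].
  by rewrite mem_cat => /orP[/mapP[q /kS + ->]|/lS].
rewrite big_cat big_map scaler_sumr /=; congr (_ + _).
by apply: eq_bigr => p _; rewrite scalerA.
Qed.

HB.instance Definition _ S := GRing.isSubmodClosed.Build R V (span S)
  (GRing.submod_closed_semi (span_closed S)).

(* The quotient module V / span S. *)
Definition quotmod (S : set V) := Quotient.quot (span S).
HB.instance Definition _ S := GRing.Zmodule.on (quotmod S).

Variable S : set V.

Definition quotmod_pi (x : V) : quotmod S := \pi_(Quotient.quot (span S)) x.

Lemma quotmod_piP x y : quotmod_pi x = quotmod_pi y <-> x - y \in span S.
Proof. by rewrite Quotient.idealrBE; split => /eqP. Qed.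

Definition quotmod_scale (r : R) (x : quotmod S) : quotmod S :=
  quotmod_pi (r *: repr x).

Lemma quotmod_scaleE r x : quotmod_scale r (quotmod_pi x) = quotmod_pi (r *: x).
Proof.
apply/quotmod_piP; rewrite -scalerBr rpredZ //; apply/quotmod_piP.
exact: reprK.
Qed.

Lemma quotmodW (P : quotmod S -> Prop) :
  (forall x, P (quotmod_pi x)) -> forall x, P x.
Proof. by move=> Ppi x; rewrite -[x]reprK; apply: Ppi. Qed.

Lemma quotmod_piD : {morph quotmod_pi : x y / x + y}.
Proof. by move=> x y; rewrite /quotmod_pi raddfD. Qed.

Lemma quotmod_scaleA a b x :
  quotmod_scale a (quotmod_scale b x) = quotmod_scale (a * b) x.
Proof. by elim/quotmodW: x => x; rewrite !quotmod_scaleE scalerA. Qed.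

Lemma quotmod_scale1 : left_id 1 quotmod_scale.
Proof. by elim/quotmodW=> x; rewrite quotmod_scaleE scale1r. Qed.

Lemma quotmod_scaleDr : right_distributive quotmod_scale +%R.
Proof.
move=> a; elim/quotmodW=> x; elim/quotmodW=> y.
by rewrite -quotmod_piD !quotmod_scaleE -quotmod_piD scalerDr.
Qed.

Lemma quotmod_scaleDl x : {morph quotmod_scale^~ x : a b / a + b}.
Proof.
elim/quotmodW: x => x a b.
by rewrite /= !quotmod_scaleE -quotmod_piD scalerDl.
Qed.

HB.instance Definition _ := GRing.Zmodule_isLmodule.Build R (quotmod S)
  quotmod_scaleA quotmod_scale1 quotmod_scaleDr quotmod_scaleDl.

Lemma quotmod_pi_is_linear : linear quotmod_pi.
Proof. by move=> a x y; rewrite quotmod_piD -quotmod_scaleE. Qed.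
HB.instance Definition _ :=
  GRing.isLinear.Build R V (quotmod S) _ quotmod_pi quotmod_pi_is_linear.

End Span.

Section AdicCompletion.
Variable R : comPzRingType.

(* Ideals of R are the submodules of the regular module R^o. *)
Definition ideal_gen (m : nat) (s : 'I_m -> R) : {pred R} :=
  @span R R^o [set x | exists j, x = s j].

Definition ideal_mul (I J : {pred R}) : {pred R} :=
  @span R R^o [set x | exists a b, [/\ a \in I, b \in J & x = a * b]].

Fixpoint ideal_exp (I : {pred R}) (n : nat) : {pred R} :=
  if n is n'.+1 then ideal_mul I (ideal_exp I n') else predT.

Variable I : {pred R}.

Lemma ideal_exp_closed n : @submod_closed R R^o (ideal_exp I n).
Proof. by case: n => [|n]; [split | exact: span_closed]. Qed.

Lemma ideal_expS n a : a \in ideal_exp I n.+1 -> a \in ideal_exp I n.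
Proof.
have [J0 Jlin] := ideal_exp_closed n.
move=> /asboolP[l lP ->]; rewrite big_seq.
elim/big_ind: _ => // [x y Jx Jy|p /lP[b [c [_ Jc ->]]]].
  by rewrite -[x]scale1r Jlin.
by rewrite scalerA -[X in X \in _]addr0 Jlin.
Qed.

Lemma ideal_exp_le m n a : (n <= m)%N ->
  a \in ideal_exp I m -> a \in ideal_exp I n.
Proof.
move=> /subnK <-; elim: (m - n)%N => // k IHk; rewrite addSn.
by move/ideal_expS/IHk.
Qed.

Variable C : lmodType R.

(* [span (ideal_exp_gens n)] is the submodule I ^ n C of C. *)
Definition ideal_exp_gens (n : nat) : set C :=
  [set x | exists a c, a \in ideal_exp I n /\ x = a *: c].

Definition adic_quot (n : nat) : lmodType R := quotmod (ideal_exp_gens n).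

Definition adic_pi (n : nat) : {linear C -> adic_quot n} :=
  @quotmod_pi R C (ideal_exp_gens n).

(* The transition map C / I ^ m C -> C / I ^ n C, meaningful for n <= m. *)
Definition adic_trans (m n : nat) (x : adic_quot m) : adic_quot n :=
  adic_pi n (repr x).

Lemma adic_transE m n c : (n <= m)%N -> adic_trans n (adic_pi m c) = adic_pi n c.
Proof.
move=> le_nm; apply/quotmod_piP.
have /quotmod_piP : adic_pi m (repr (adic_pi m c)) = adic_pi m c by exact: reprK.
move=> /asboolP[l lP e]; apply/asboolP; exists l => // p /lP[a [d [Ja ->]]].
by exists a, d; split=> //; exact: ideal_exp_le Ja.
Qed.

(* The limit of C / I ^ n.+1 C over n : nat, i.e. of C / I ^ n C over n >= 1. *)
Record adic_lim := AdicLim {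
  adic_coord :> forall n, adic_quot n.+1;
  adic_compat : forall m n, (n <= m)%N ->
    adic_trans n.+1 (adic_coord m) = adic_coord n
}.

Lemma adic_lim_ext (x y : adic_lim) : (forall n, x n = y n) -> x = y.
Proof.
case: x y => [x xP] [y yP] /= exy.
have {}exy : x = y by exact: functional_extensionality_dep.
by subst y; congr AdicLim; exact: Prop_irrelevance.
Qed.

Definition adic_to_lim (c : C) : adic_lim :=
  @AdicLim (fun n => adic_pi n.+1 c) (fun m n le_nm => @adic_transE m.+1 n.+1 c le_nm).

(* Only surjectivity is required: C need not be I-adically separated. *)
Definition adically_complete : Prop := forall x : adic_lim, exists c, adic_to_lim c = x.

End AdicCompletion.

(* Main.v *)
(* If C is s-contraadjusted, then for every sequence (c_n) in C the system
   b_n = c_n + s b_(n+1) is solvable: a solution is read off a splitting of the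
   extension of R[1/s] by C in which the fractions 1/s^n have lifts e_n with
   s e_(n+1) = e_n + c_n.  Unrolling the system, b_0 is a sum of the series
   of the s^n c_n, modulo s^n C for every n.
   Now I^(mk+1) is contained in the ideal generated by s_1^k, ..., s_m^k, so a
   sparse enough subsequence of a Cauchy sequence in C has increments of the
   form sum_j s_j^k c_(j,k), and the m series over k are summed separately. *)

From HB Require Import structures.
From mathcomp Require Import all_boot all_algebra.
From mathcomp Require Import boolp classical_sets functions.
From mathcomp Require Import zify.
Require Import Defs.
Set Implicit Arguments.
Unset Strict Implicit.
Unset Printing Implicit Defensive.
Import GRing.Theory.
Local Open Scope ring_scope.

(** * Spans of sets in a module *)

Lemma span_min (R : pzRingType) (V : lmodType R) (S : set V) (P : V -> Prop) :
  P 0 -> (forall x y, P x -> P y -> P (x + y)) ->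
  (forall a x, S x -> P (a *: x)) -> forall x, x \in span S -> P x.
Proof.
move=> P0 PD PZ x /asboolP[l lS ->]; rewrite big_seq.
by elim/big_ind: _ => // p /lS; apply: PZ.
Qed.

Lemma mem_span (R : pzRingType) (V : lmodType R) (S : set V) (a : R) (x : V) :
  S x -> a *: x \in span S.
Proof.
move=> Sx; apply/asboolP; exists [:: (a, x)]; last by rewrite big_seq1.
by move=> p; rewrite inE => /eqP ->.
Qed.

(** * Germs at infinity of sequences in [C] *)

Section Germs.
Variables (R : comPzRingType) (C : lmodType R).

Definition eventually_zero : set (nat -> C) :=
  [set u | exists n, forall k, (n <= k)%N -> u k = 0].

Definition germ (u : nat -> C) : quotmod eventually_zero :=
  @quotmod_pi R _ eventually_zero u.

(** The eventually zero sequences are already closed under linear combinations, so passing to their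
    span adds nothing. *)
Lemma germP (u v : nat -> C) :
  germ u = germ v <-> exists n, forall k, (n <= k)%N -> u k = v k.
Proof.
split=> [/quotmod_piP|[n uv]]; last first.
  apply/quotmod_piP; rewrite -[_ - _]scale1r; apply: mem_span.
  by exists n => k /uv e; apply/eqP; rewrite subr_eq0; apply/eqP.
have ez w : w \in span eventually_zero -> eventually_zero w.
  apply: span_min => [|x y [m xm] [n yn]|a x [n xn]].
  - by exists 0%N.
  - exists (maxn m n) => k; rewrite geq_max => /andP[/xm xk /yn yk].
    by change (x k + y k = 0); rewrite xk yk addr0.
  - by exists n => k /xn xk; change (a *: x k = 0); rewrite xk scaler0.
move=> /ez[n uv]; exists n => k /uv e.
by apply/eqP; rewrite -subr_eq0; apply/eqP.
Qed.

Lemma germ_linear (a : R) (u v : nat -> C) :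
  germ (fun k => a *: u k + v k) = a *: germ u + germ v.
Proof. by rewrite -[RHS]quotmod_pi_is_linear. Qed.

End Germs.

(* The telescope extension of [R[1/s]] by [C] is realized inside the product of
   the germs at infinity of sequences in [C] with [R[1/s]]. *)
Section Telescope.
Variables (R : comPzRingType) (s : R) (C : lmodType R) (c : nat -> C).

(** Unrolling [e_n = s *: e_n.+1 - c n] up to [N] gives [e_n = s ^+ (N - n) *: e_N - tail_sum n N];
    the germ in [tel] keeps only the part in [C]. *)
Definition tail_sum (n N : nat) : C := \sum_(n <= k < N) s ^+ (k - n) *: c k.

Lemma tail_sumS n N : (n < N)%N ->
  tail_sum n N = c n + s *: tail_sum n.+1 N.
Proof.
move=> ltnN; rewrite /tail_sum big_ltn // subnn expr0 scale1r; congr (_ + _).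
rewrite scaler_sumr !big_seq; apply: eq_bigr => k.
rewrite mem_index_iota => /andP[ltnk _].
by rewrite scalerA -exprS -subSn // subSS.
Qed.

Local Notation mid := (quotmod (@eventually_zero R C) * localization s)%type.

(* Represents [d + a *: e_n], where [e_n] lifts [1 / s ^ n] and
   [s *: e_n.+1 = e_n + c n]. *)
Definition tel (d : C) (a : R) (n : nat) : mid :=
  (germ (fun N => d - a *: tail_sum n N), frac s a n).

Lemma tel_shift d a n : tel d a n = tel (d - a *: c n) (s * a) n.+1.
Proof.
congr pair; last by apply: frac_eq; rewrite exprS mulrCA mulrA.
(* For [N <= n] both tail sums are empty and the sequences may differ, which is why germs are
   taken. *)
apply/germP; exists n.+1 => N ltnN.
by rewrite tail_sumS // scalerDr scalerA (mulrC s) opprD addrA.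
Qed.

(** Plays the role of expanding a fraction: it brings two elements to a common index. *)
Lemma tel_raise d a n k : exists d', tel d a n = tel d' (s ^+ k * a) (k + n).
Proof.
elim: k => [|k [d' ->]]; first by exists d; rewrite mul1r.
by exists (d' - (s ^+ k * a) *: c (k + n)); rewrite tel_shift mulrA -exprS addSn.
Qed.

Lemma frac_linear r a b n : frac s (r * a + b) n = r *: frac s a n + frac s b n.
Proof.
rewrite [r *: _]loc_scaleE [RHS]loc_addE; apply: frac_eq.
by rewrite exprD -mulrDr mulrA.
Qed.

Lemma tel_linear r d a d' a' n :
  tel (r *: d + d') (r * a + a') n = r *: tel d a n + tel d' a' n.
Proof.
congr pair; last exact: frac_linear.
rewrite -[RHS]germ_linear; congr germ; apply/funext => N.
by rewrite scalerBr scalerDl opprD scalerA addrACA.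
Qed.

Definition telescope : {pred mid} := fun x => `[< exists d a n, x = tel d a n >].

Lemma mem_tel d a n : tel d a n \in telescope.
Proof. by apply/asboolP; exists d, a, n. Qed.

Lemma tel0 d n : tel d 0 n = tel d 0 0.
Proof.
congr pair; last by apply: frac_eq; rewrite !mulr0.
by congr germ; apply/funext => N; rewrite !scale0r.
Qed.

Lemma telC0 : tel 0 0 0 = 0.
Proof.
have := tel_linear (-1) 0 0 0 0 0.
by rewrite scaler0 mulr0 !addr0 scaleN1r addNr.
Qed.

Lemma telescope_closed : submod_closed telescope.
Proof.
split=> [|r x y /asboolP[d [a [n ->]]] /asboolP[d' [a' [n' ->]]]].
  by rewrite -telC0 mem_tel.
have [d1 ->] := tel_raise d a n n'; have [d2 ->] := tel_raise d' a' n' n.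
by rewrite [(n' + n)%N]addnC -tel_linear mem_tel.
Qed.

HB.instance Definition _ := GRing.isSubmodClosed.Build R mid telescope
  (GRing.submod_closed_semi telescope_closed).

Definition tel_module := {x : mid | x \in telescope}.
HB.instance Definition _ := SubType.on tel_module.
HB.instance Definition _ := Choice.on tel_module.
HB.instance Definition _ := [SubChoice_isSubLmodule of tel_module by <:].

Definition tel_elt d a n : tel_module := Sub (tel d a n) (mem_tel d a n).

Definition tel_inj (d : C) : tel_module := tel_elt d 0 0.

Lemma tel_inj_is_linear : linear tel_inj.
Proof.
move=> r d d'; apply: val_inj; rewrite linearP /= -tel_linear.
by rewrite mulr0 addr0.
Qed.
HB.instance Definition _ :=
  GRing.isLinear.Build R C tel_module _ tel_inj tel_inj_is_linear.

Definition tel_proj (x : tel_module) : localization s := (val x).2.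

Lemma tel_proj_is_linear : linear tel_proj.
Proof. by move=> r x y; rewrite /tel_proj linearP. Qed.
HB.instance Definition _ :=
  GRing.isLinear.Build R tel_module (localization s) _ tel_proj
    tel_proj_is_linear.

Lemma tel_inj_inj : injective tel_inj.
Proof.
move=> d d' /(congr1 (fun x => (val x).1))/germP[n e].
by have := e n (leqnn n); rewrite !scale0r !subr0.
Qed.

Lemma tel_proj_surj x : exists y, tel_proj y = x.
Proof. by elim/fracW: x => a n; exists (tel_elt 0 a n). Qed.

Lemma tel_exact x : tel_proj x = 0 <-> exists d, tel_inj d = x.
Proof.
split=> [|[d <-]]; last by [].
have /asboolP[d [a [n ex]]] := valP x.
rewrite /tel_proj ex => /eqP/fracP[k].
rewrite expr0 mul1r !mulr0 => ka0.
(* A zero fraction has a numerator killed by some [s ^+ k]; raising the index by [k] makes the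
   coefficient vanish and leaves an element of [C]. *)
have [d' ed] := tel_raise d a n k; exists d'; apply: val_inj.
by rewrite ex ed ka0 tel0.
Qed.

Definition tel_extension : extension (localization s) C :=
  Extension tel_inj_inj tel_proj_surj tel_exact.

Lemma contraadjusted_solvable : contraadjusted s C ->
  exists b : nat -> C, forall n, b n = c n + s *: b n.+1.
Proof.
move=> /(_ tel_extension)[f [_ f_inj _]].
have f1D x y : (f (x + y)).1 = (f x).1 + (f y).1 by rewrite linearD.
have f1Z r x : (f (r *: x)).1 = r *: (f x).1 by rewrite linearZ.
(* The first component of [f] is a retraction onto [C]. Applied to [e_n = s *: e_n.+1 - c n] it
   solves the system up to sign. *)
exists (fun n => - (f (tel_elt 0 1 n)).1) => n.
have -> : tel_elt 0 1 n = s *: tel_elt 0 1 n.+1 + tel_inj (- c n).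
  apply: val_inj; rewrite linearP /= tel_shift scale1r sub0r mulr1.
  by rewrite -(tel0 _ n.+1) -tel_linear mulr1 scaler0 addr0 add0r.
have := f_inj (- c n); rewrite /= => e.
by rewrite f1D f1Z e /= opprD opprK scalerN addrC.
Qed.

End Telescope.

(* Pigeonhole: a monomial of degree [n > \sum_j e j] in the generators is
   divisible by [s j ^+ e j] for some [j]. *)
Lemma ideal_exp_pigeonhole (R : comPzRingType) m (s : 'I_m -> R) n
    (e : 'I_m -> nat) a :
  (\sum_j e j < n)%N -> a \in ideal_exp (ideal_gen s) n ->
  exists r : 'I_m -> R, a = \sum_j s j ^+ e j * r j.
Proof.
pose P (e : 'I_m -> nat) a := exists r, a = \sum_j s j ^+ e j * r j.
rewrite -/(P e a).
have P0 e' : P e' 0.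
  by exists (fun=> 0); rewrite big1 // => j _; rewrite mulr0.
have PD e' x y : P e' x -> P e' y -> P e' (x + y).
  move=> [r ->] [t ->]; exists (fun j => r j + t j).
  by rewrite -big_split; apply: eq_bigr => j _; rewrite mulrDr.
have PM e' b x : P e' x -> P e' (b * x).
  move=> [r ->]; exists (fun j => b * r j).
  by rewrite mulr_sumr; apply: eq_bigr => j _; rewrite mulrCA.
have P1 e' j b : P e' (s j ^+ e' j * b).
  exists (fun i => if i == j then b else 0).
  rewrite (bigD1 j) //= eqxx big1 ?addr0 // => i /negbTE ->; exact: mulr0.
(* The exponents [e] stay general, since splitting off a factor [s j] lowers [e j]. *)
elim: n e a => // n IHn e a len; rewrite /= /ideal_mul.
apply: (@span_min _ R^o); [exact: P0 | exact: PD |].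
move=> b _ [x [y [Ix Iy ->]]]; apply: (PM); move: x Ix.
apply: (@span_min _ R^o (fun x => exists j, x = s j) (fun x => P e (x * y))).
- by rewrite mul0r.
- by move=> x x' Px Px'; rewrite mulrDl; apply: PD.
move=> c _ [j ->]; rewrite -mulrA; apply: PM.
have [ej0|ej_gt0] := posnP (e j).
  by rewrite -[_ * _]mul1r -(expr0 (s j)) -ej0.
(* Both sides of the degree bound drop by one; [e j > 0] keeps the truncated subtraction exact. *)
have : P (fun i => e i - (i == j))%N y.
  apply: IHn Iy; move: len; rewrite (bigD1 j) // [X in (_ < X)%N -> _]/=.
  rewrite [X in _ -> (X < _)%N](bigD1 j) //= eqxx.
  rewrite [X in _ -> (_ + X < _)%N](eq_bigr e); first by lia.
  by move=> i /negbTE ->; rewrite subn0.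
(* The factor [s j] restores the exponent at [j] and is absorbed by the coefficients elsewhere. *)
move=> [r ->]; exists (fun i => if i == j then r i else s j * r i).
rewrite mulr_sumr; apply: eq_bigr => i _.
case: eqP => [->|_]; last by rewrite subn0 mulrCA.
by rewrite mulrA -exprS subn1 prednK.
Qed.

Lemma gen_exp (R : comPzRingType) m (s : 'I_m -> R) j n :
  s j ^+ n \in ideal_exp (ideal_gen s) n.
Proof.
elim: n => [|n IHn] //.
rewrite -[_ ^+ _]mul1r; apply: (@mem_span _ R^o).
exists (s j), (s j ^+ n); split; rewrite ?exprS //.
by rewrite -[s j]mul1r; apply: (@mem_span _ R^o); exists j.
Qed.

(** * Convergence of Cauchy sequences *)

Section Completeness.
Variables (R : comPzRingType) (m : nat) (s : 'I_m -> R) (C : lmodType R).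
Local Notation I := (ideal_gen s).
Local Notation IC n := (span (@ideal_exp_gens R I C n)).

Lemma span_ideal_exp_pigeonhole n (e : 'I_m -> nat) x :
  (\sum_j e j < n)%N -> x \in IC n ->
  exists c : 'I_m -> C, x = \sum_j s j ^+ e j *: c j.
Proof.
move=> len; move: x; apply: span_min.
- by exists (fun=> 0); rewrite big1 // => j _; rewrite scaler0.
- move=> x y [r ->] [t ->]; exists (fun j => r j + t j).
  by rewrite -big_split; apply: eq_bigr => j _; rewrite scalerDr.
move=> b _ [a [c [/(ideal_exp_pigeonhole len)[r ->] ->]]].
exists (fun j => (b * r j) *: c); rewrite scalerA mulr_sumr scaler_suml.
by apply: eq_bigr => j _; rewrite scalerA mulrCA.
Qed.

Lemma span_ideal_exp_le n p x : (n <= p)%N -> x \in IC p -> x \in IC n.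
Proof.
move=> le_np /asboolP[l lP ->]; apply/asboolP; exists l => // q /lP[a [c [Ia ->]]].
by exists a, c; split=> //; apply: ideal_exp_le Ia.
Qed.

Lemma gen_exp_scale j n c : s j ^+ n *: c \in IC n.
Proof.
rewrite -[_ *: _]scale1r; apply: mem_span.
by exists (s j ^+ n), c; split=> //; apply: gen_exp.
Qed.

Hypothesis solvable : forall j (c : nat -> C),
  exists b : nat -> C, forall n, b n = c n + s j *: b n.+1.

Lemma cauchy_converges (v : nat -> C) :
  (forall k, v k.+1 - v k \in IC (m * k).+1) ->
  exists c, forall n, c - v n \in IC n.
Proof.
move=> vP.
have /choice[c cP] k : exists c : 'I_m -> C, v k.+1 - v k = \sum_j s j ^+ k *: c j.
  by apply: span_ideal_exp_pigeonhole (vP k); rewrite sum_nat_const card_ord.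
have /choice[b bP] j := solvable j (c^~ j).
exists (v 0 + \sum_j b j 0) => n.
(* The error after [n] steps is the sum of the remainders of the [m] series, visibly in
   [I ^ n C]. *)
have -> : v 0 + \sum_j b j 0 - v n = \sum_j s j ^+ n *: b j n.
  elim: n => [|n IHn].
    by rewrite addrC addKr; apply: eq_bigr => j _; rewrite scale1r.
  rewrite -[LHS](subrKA (v n)) IHn -[v n - _]opprB cP -sumrB.
  apply: eq_bigr => j _; rewrite -scalerBr bP.
  by rewrite addrC addKr scalerA -exprSr.
by apply: rpred_sum => j _; apply: gen_exp_scale.
Qed.

End Completeness.

Theorem theorem5p6 (R : comPzRingType) (m : nat) (s : 'I_m -> R)
    (C : lmodType R) :
  (forall j : 'I_m, contraadjusted (s j) C) ->
  adically_complete (ideal_gen s) C.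
Proof.
move=> sC x.
have /choice[u uP] n : exists u, adic_pi (ideal_gen s) C n.+1 u = x n.
  by exists (repr (x n)); apply: reprK.
have uB n p : (n <= p)%N -> u p - u n \in span (@ideal_exp_gens R (ideal_gen s) C n.+1).
  move=> le_np; apply/quotmod_piP.
  rewrite -[RHS]/(adic_pi _ _ _ _) uP -(adic_compat x le_np) -(uP p).
  by rewrite adic_transE.
(* The factor [m.+1], rather than [m], keeps the subsequence cofinal when [m = 0]. *)
pose v k := u (m.+1 * k)%N.
have [k|c cP] := @cauchy_converges _ _ s C (fun j c => contraadjusted_solvable c (sC j)) v.
  by apply: (@span_ideal_exp_le _ _ _ _ _ (m.+1 * k).+1); rewrite ?uB //; lia.
exists c; apply: adic_lim_ext => n /=; rewrite -uP; apply/quotmod_piP.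
(* The index is [n.+1] because [x n] lives modulo [I ^ n.+1 C]. *)
rewrite -(subrKA (v n.+1)); apply: rpredD (cP _) _.
by apply: uB; lia.
Qed.
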